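(* Let $(Y,\sigma)$ be any subshift. Then $(Y,\sigma)$ is topologically conjugate to the Fibonacci system $(X_\varphi,\sigma)$ if and only if there exist $n\ge 3$ and two words $B_0$ and $B_1$, of lengths $F_n$ and $F_{n-1}$ respectively, such that every $y\in Y$ is a concatenation of $B_0$'s and $B_1$'s, and moreover, whenever $\cdots B_{x_{-1}}B_{x_0}B_{x_1}\cdots B_{x_k}\cdots$ (with all $x_k\in\{0,1\}$) is such a concatenation of some $y\in Y$, the sequence $x=(x_k)_{k\in\mathbb Z}$ belongs to $X_\varphi$.
   Context: A subshift $(Y,\sigma)$ is a non-empty closed shift-invariant subset $Y\subseteq A^{\mathbb Z}$, $A$ a finite alphabet, with the left shift $\sigma$. ''$y$ is a concatenation of $B_0$'s and $B_1$'s'' means that $y$ can be cut into consecutive blocks each equal to $B_0$ or $B_1$, where the coordinate $0$ of $y$ may be at any position inside a block (i.e. $y=\sigma^j(\cdots B_{x_{-1}}\cdot B_{x_0}B_{x_1}\cdots)$ for some $j\in\mathbb Z$ and $x\in\{0,1\}^{\mathbb Z}$). The Fibonacci numbers are $F_1=F_2=1$, $F_{n+1}=F_n+F_{n-1}$. The Fibonacci substitution is $\varphi:0\mapsto 01,\ 1\mapsto 0$ on $\{0,1\}$; $X_\varphi\subset\{0,1\}^{\mathbb Z}$ is the set of two-sided sequences all of whose finite subwords occur in some $\varphi^k(0)$, $k\ge1$ (equivalently, the shift-orbit closure of a two-sided fixed point of $\varphi^2$). Topologically conjugate means there is a homeomorphism $\psi:X_\varphi\to Y$ with $\psi\sigma=\sigma\psi$.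 *)

(* Defs.v *)
From HB Require Import structures.
From mathcomp Require Import all_boot all_order all_algebra.
From mathcomp Require Import all_classical topology.

Set Implicit Arguments.
Unset Strict Implicit.
Unset Printing Implicit Defensive.

Import Order.TTheory GRing.Theory Num.Theory.
Local Open Scope classical_set_scope.
Local Open Scope ring_scope.

Definition fullshift (A : finType) : topologicalType :=
  prod_topology (fun _ : int => discrete_topology A).

Definition shift (A : finType) (x : fullshift A) : fullshift A :=
  fun k => x (k + 1).

Definition subshift (A : finType) (Y : set (fullshift A)) : Prop :=
  [/\ Y !=set0, closed Y & @shift A @` Y = Y].

(* [f] restricts to a homeomorphism from [X] to [Y] (subspace topologies); its
   values outside [X], and those of the inverse outside [Y], are irrelevant. *)
Definition homeomorphism_on (U V : topologicalType) (X : set U) (Y : set V)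
    (f : U -> V) : Prop :=
  [/\ set_bij X Y f,
      {within X, continuous f} &
      exists2 g : V -> U, {within Y, continuous g} & {in X, cancel f g}].

Definition conjugate (A B : finType)
    (X : set (fullshift A)) (Y : set (fullshift B)) : Prop :=
  exists2 psi : fullshift A -> fullshift B,
    homeomorphism_on X Y psi &
    forall x, X x -> psi (shift x) = shift (psi x).

(* The subword x_i x_(i+1) ... x_(i+m-1). *)
Definition subword (A : finType) (x : fullshift A) (i : int) (m : nat) : seq A :=
  mkseq (fun k => x (i + k%:Z)) m.

(* The letters 0 and 1 are [false] and [true]. *)
Definition fib_subst (w : seq bool) : seq bool :=
  flatten [seq if a then [:: false] else [:: false; true] | a <- w].

Definition fib_shift : set (fullshift bool) :=
  [set x | forall (i : int) (m : nat), exists2 k : nat,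
     (1 <= k)%N & infix (subword x i m) (iter k fib_subst [:: false])].

Fixpoint fib (n : nat) : nat :=
  match n with
  | 0 => 0
  | 1 => 1
  | (m.+1 as n').+1 => fib n' + fib m
  end.

Definition block (A : finType) (B0 B1 : seq A) (a : bool) : seq A :=
  if a then B1 else B0.

(* [y] is a shift of ... B_{x_{-1}} . B_{x_0} B_{x_1} ... : the block with index
   k starts at the coordinate [c k] of [y], and [c 0] is arbitrary. When B0 and
   B1 are nonempty, the blocks partition all the coordinates of [y]. *)
Definition concatenation_along (A : finType) (B0 B1 : seq A)
    (x : fullshift bool) (y : fullshift A) : Prop :=
  exists c : int -> int, forall k : int,
    c (k + 1) = c k + (size (block B0 B1 (x k)))%:Z /\
    subword y (c k) (size (block B0 B1 (x k))) = block B0 B1 (x k).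

(* Main.v *)
Require Import Defs.
From HB Require Import structures.
From mathcomp Require Import all_boot all_order all_algebra.
From mathcomp Require Import all_classical topology.
From mathcomp Require Import zify.

(* The substitution turns a concatenation of blocks (U, V) along the Fibonacci
   shift into a concatenation of (UV, U) along the Fibonacci shift, so block codings
   can be lifted to arbitrarily high levels. At level k every cut, of any coding
   whatsoever, is followed by the same word P, the "marker", of length about
   |U| + |V|, which has periods |U| and |V|. If cuts of two codings of one sequence
   were at distance 0 < q <= |U|/2, then P would also have period q and, |U| and |V|
   being coprime, P would be constant by Fine and Wilf; hence, unless the two
   original blocks are powers of one letter, high level codings are unique and
   locally determined.

   A subshift coded along the Fibonacci shift is therefore conjugate to the Fibonacci
   shift itself, coded by phi^k(0) and phi^k(1) of the same lengths: keep the cuts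
   and replace the blocks. Conversely a conjugacy is a sliding block code of some
   radius r, and as the words phi^k(0) and phi^k(1) are always followed by the same
   2r letters for large k, it maps them, up to a translation by r, to two blocks. *)

Set Implicit Arguments.
Unset Strict Implicit.
Unset Printing Implicit Defensive.

Import Order.TTheory GRing.Theory Num.Theory.
Local Open Scope classical_set_scope.
Local Open Scope ring_scope.

(** * Markers of block codings *)

Definition has_period (T : Type) (f : nat -> T) (L p : nat) : Prop :=
  forall i, (i + p < L)%N -> f i = f (i + p)%N.

(** Euclid's algorithm by subtraction: if [q = p + r], then [f] has period [r] on its first [L - p]
    positions, and period [p] carries the period found there to the remaining ones. *)
Lemma fine_wilf (T : Type) (f : nat -> T) (L p q : nat) :
  (0 < p)%N -> (0 < q)%N -> (p + q <= L)%N ->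
  has_period f L p -> has_period f L q -> has_period f L (gcdn p q).
Proof.
have [n] := ubnP (p + q); elim: n L p q => // n IH L p q.
wlog le_pq : p q / (p <= q)%N.
  move=> wl le_n p0 q0 leL fp fq; case: (leqP p q) => [|/ltnW] le; first exact: wl.
  by rewrite gcdnC; apply: wl; rewrite // addnC.
rewrite leq_eqVlt in le_pq; case/orP: le_pq => [/eqP -> *|lt_pq].
  by rewrite gcdnn.
have [r -> {lt_pq}] : exists r, q = (p + r)%N by exists (q - p)%N; lia.
case: r => [|r] le_n p0 q0 leL fp fq; first by rewrite addn0 gcdnn.
have fr : has_period f (L - p) r.+1.
  move=> i lti; rewrite (fq i); last by lia.
  rewrite [RHS]fp; last by lia.
  by congr f; lia.
have fpL : has_period f (L - p) p by move=> i lti; apply: fp; lia.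
have fg : has_period f (L - p) (gcdn p r.+1) by apply: IH; rewrite // ?ltn0Sn; lia.
have [g_p g_r] : (gcdn p r.+1 <= p /\ gcdn p r.+1 <= r.+1)%N.
  by split; apply: dvdn_leq; rewrite ?dvdn_gcdl ?dvdn_gcdr.
rewrite gcdnDl; move: (gcdn p r.+1) g_p g_r fg => g g_p g_r fg i lti.
case: (ltnP (i + g) (L - p)) => [|le_i]; first exact: fg.
(* Here [2 * p + r.+1 <= L] and [g <= r.+1] force [p <= i], so both positions can be moved back by
   [p]. *)
have [j def_i] : exists j, i = (j + p)%N by exists (i - p)%N; lia.
rewrite def_i -(fp j); last by lia.
rewrite addnAC -(fp (j + _)%N); last by lia.
by apply: fg; lia.
Qed.

Section Subwords.
Variable A : finType.
Implicit Types i j : int.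

Lemma size_subword (x : fullshift A) i m : size (subword x i m) = m.
Proof. exact: size_mkseq. Qed.

Lemma subwordD (x : fullshift A) i m n :
  subword x i (m + n) = subword x i m ++ subword x (i + m%:Z) n.
Proof.
rewrite /subword /mkseq iotaD map_cat add0n.
have -> : iota m n = map (addn m) (iota 0 n) by rewrite -iotaDl addn0.
rewrite -map_comp.
by congr cat; apply: eq_map => k /=; rewrite PoszD addrA.
Qed.

Lemma subword1 (x : fullshift A) i : subword x i 1 = [:: x i].
Proof. by rewrite /subword /mkseq /= addr0. Qed.

Lemma eq_subwordP (x y : fullshift A) i j m :
  subword x i m = subword y j m <->
  (forall k, (k < m)%N -> x (i + k%:Z) = y (j + k%:Z)).
Proof.
split=> [eq_xy k lt_km|eq_xy]; last first.
  by apply/eq_in_map => k; rewrite mem_iota /= => /eq_xy.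
have := congr1 (fun s => nth (x i) s k) eq_xy.
by rewrite /subword !nth_mkseq.
Qed.

Lemma nth_subword a (x : fullshift A) i m k : (k < m)%N ->
  nth a (subword x i m) k = x (i + k%:Z).
Proof. exact: nth_mkseq. Qed.

Lemma take_subword (x : fullshift A) i m n :
  (m <= n)%N -> take m (subword x i n) = subword x i m.
Proof.
by move=> le; rewrite -(subnKC le) subwordD take_size_cat // size_subword.
Qed.

End Subwords.

Section Words.
Variable A : finType.
Implicit Types (B U V P : seq A) (y : fullshift A) (i d e : int).

Definition spell B0 B1 (w : seq bool) : seq A :=
  flatten [seq block B0 B1 a | a <- w].

Lemma spell_cat B0 B1 w1 w2 :
  spell B0 B1 (w1 ++ w2) = spell B0 B1 w1 ++ spell B0 B1 w2.
Proof. by rewrite /spell map_cat flatten_cat. Qed.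

Lemma spell1 B0 B1 a : spell B0 B1 [:: a] = block B0 B1 a.
Proof. by rewrite /spell /= cats0. Qed.

(** The cuts are a parameter here, unlike in [concatenation_along], so that those of different
    codings can be compared. *)
Definition coding (c : int -> int) B0 B1 (x : fullshift bool) y : Prop :=
  forall k : int,
    c (k + 1) = c k + (size (block B0 B1 (x k)))%:Z /\
    subword y (c k) (size (block B0 B1 (x k))) = block B0 B1 (x k).

Lemma coding_spell c B0 B1 (x : fullshift bool) y : coding c B0 B1 x y -> forall m i,
  c (i + m%:Z) = c i + (size (spell B0 B1 (subword x i m)))%:Z /\
  subword y (c i) (size (spell B0 B1 (subword x i m)))
    = spell B0 B1 (subword x i m).
Proof.
move=> cod; elim=> [|m IH] i; first by rewrite !addr0.
have [IHc IHy] := IH i; have [codc cody] := cod (i + m%:Z).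
rewrite -addn1 subwordD subword1 spell_cat spell1 size_cat.
rewrite PoszD addrA codc IHc PoszD addrA; split=> //.
by rewrite subwordD IHy -IHc cody.
Qed.

Lemma coding_lift c B0 B1 (x : fullshift bool) y : coding c B0 B1 x y ->
  forall x', @concatenation_along _ [:: false; true] [:: false] x' x ->
  @concatenation_along _ (B0 ++ B1) B0 x' y.
Proof.
move=> /coding_spell cod x' [c' cod'].
exists (fun k => c (c' k)) => k; have [-> codx] := cod' k.
have -> : block (B0 ++ B1) B0 (x' k)
    = spell B0 B1 (subword x (c' k) (size (block [:: false; true] [:: false] (x' k)))).
  by rewrite codx /spell /block; case: (x' k); rewrite /= ?cats0.
exact: cod.
Qed.

Definition tower B0 B1 k a : seq A := spell B0 B1 (iter k fib_subst [:: a]).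

Lemma fib_subst_cat w1 w2 : fib_subst (w1 ++ w2) = fib_subst w1 ++ fib_subst w2.
Proof. by rewrite /fib_subst map_cat flatten_cat. Qed.

Lemma iter_fib_subst_cat k w1 w2 :
  iter k fib_subst (w1 ++ w2) = iter k fib_subst w1 ++ iter k fib_subst w2.
Proof. by elim: k => //= k ->; rewrite fib_subst_cat. Qed.

Lemma tower0 B0 B1 a : tower B0 B1 0 a = block B0 B1 a.
Proof. exact: spell1. Qed.

Lemma towerS B0 B1 k a : tower B0 B1 k.+1 a =
  if a then tower B0 B1 k false else tower B0 B1 k false ++ tower B0 B1 k true.
Proof.
rewrite /tower iterSr; case: a => //.
by rewrite -spell_cat -iter_fib_subst_cat.
Qed.

(* With U and V the blocks of level k, this is a common prefix of UV and VU, of length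
   |U| + |V| - (|B0| + |B1|). *)
Fixpoint marker B0 B1 k : seq A :=
  if k is k'.+1 then tower B0 B1 k' false ++ marker B0 B1 k' else [::].

(** If M is the marker for blocks U and V, the next level asks that UM be a prefix of UUM and of
    UVUM; both follow from M being a prefix of UM and of VM. *)
Lemma marker_prefix B0 B1 k a :
  prefix (marker B0 B1 k) (tower B0 B1 k a ++ marker B0 B1 k).
Proof.
elim: k a => [|k IH] a; first exact: prefix0s.
case: a; rewrite towerS /= -?catA prefix_catr ?eqxx //=.
by apply: prefix_trans (IH true) _; rewrite prefix_catr ?eqxx //=.
Qed.

Lemma marker_size B0 B1 k : (0 < size B0)%N -> (k <= size (marker B0 B1 k))%N.
Proof.
move=> B00; elim: k => //= k IH; rewrite size_cat.
suff : (0 < size (tower B0 B1 k false))%N by lia.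
elim: k {IH} => [|k IH]; first by rewrite tower0.
by rewrite towerS size_cat; lia.
Qed.

(** By iteration [P] is a prefix of the spelled word followed by [P]; as the blocks are nonempty,
    the spelled word alone is already long enough. *)
Lemma prefix_spell U V P w : (0 < size U)%N -> (0 < size V)%N ->
  (forall a, prefix P (block U V a ++ P)) ->
  (size P <= size w)%N -> prefix P (spell U V w).
Proof.
move=> U0 V0 prP le_Pw.
have prw : prefix P (spell U V w ++ P).
  elim: w {le_Pw} => [|a w IH]; first exact: prefix_refl.
  rewrite /spell /= -catA; apply: prefix_trans (prP a) _.
  by rewrite prefix_catr ?eqxx.
have le_w : (size w <= size (spell U V w))%N.
  elim: w {le_Pw prw} => // a w IH; rewrite -cat1s spell_cat spell1 !size_cat.
  by case: a => /=; lia.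
by move: prw; rewrite !prefixE takel_cat // (leq_trans le_Pw).
Qed.

Lemma coding_marker c U V P (x : fullshift bool) y : (0 < size U)%N -> (0 < size V)%N ->
  (forall a, prefix P (block U V a ++ P)) -> coding c U V x y ->
  forall k, subword y (c k) (size P) = P.
Proof.
move=> U0 V0 prP cod k; have [_ cody] := coding_spell cod (size P) k.
have prw : prefix P (spell U V (subword x k (size P))).
  by apply: prefix_spell => //; rewrite size_subword.
have le_P := size_prefix prw.
rewrite -(take_subword y (c k) le_P) cody.
by apply/eqP; rewrite -prefixE.
Qed.

Lemma marker_period y d q P a :
  subword y d (size P) = P -> subword y (d + q%:Z) (size P) = P ->
  has_period (nth a P) (size P) q.
Proof.
move=> eq1 eq2 i lti; rewrite -{1}eq2 -{2}eq1 /subword !nth_mkseq //; last by lia.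
by congr y; rewrite PoszD; lia.
Qed.

Lemma prefix_period U P a :
  prefix P (U ++ P) -> has_period (nth a P) (size P) (size U).
Proof.
move=> /prefixP [s def_P] i lti.
have -> : nth a P (i + size U) = nth a (P ++ s) (i + size U) by rewrite nth_cat lti.
rewrite -def_P nth_cat ifF; last by lia.
by rewrite addnK.
Qed.

(** Fine and Wilf is applied twice: first to [q] and |U|, then to their gcd and |V|, where
    coprimality yields period 1. Since q <= |U|/2 and |P| >= 3|U|/2, the word [P] is long enough
    both times. *)
Lemma marker_rigid U V P y d q :
  coprime (size U) (size V) -> (0 < size V <= size U)%N ->
  (3 * size U <= 2 * size P)%N ->
  prefix P (U ++ P) -> prefix P (V ++ P) ->
  subword y d (size P) = P -> subword y (d + q%:Z) (size P) = P ->
  (0 < q)%N -> (2 * q <= size U)%N -> exists a, all (pred1 a) P.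
Proof.
move=> co_UV /andP [V0 le_VU] le_P prU prV y_d y_dq q0 le_q.
have [a0 P_a0] : exists a0, nth a0 P 0 = a0.
  case: P {prU prV y_d y_dq} le_P => [|a ? _]; first by rewrite muln0; lia.
  by exists a.
exists a0.
have per_q := marker_period a0 y_d y_dq.
have per_U := prefix_period a0 prU.
have per_V := prefix_period a0 prV.
have le1 : (q + size U <= size P)%N by lia.
have per_g := fine_wilf q0 (leq_trans V0 le_VU) le1 per_q per_U.
have g0 : (0 < gcdn q (size U))%N by rewrite gcdn_gt0 q0.
have le_g : (gcdn q (size U) <= q)%N by rewrite dvdn_leq ?dvdn_gcdl.
have le2 : (gcdn q (size U) + size V <= size P)%N.
  by apply: leq_trans le1; rewrite leq_add.
have := fine_wilf g0 V0 le2 per_g per_V.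
rewrite -gcdnA (eqP co_UV) gcdn1 => per_1.
apply/(all_nthP a0) => i lti /=; apply/eqP.
elim: i lti => // i IH lti; rewrite -[RHS](IH (ltnW lti)) -addn1 -per_1 //.
by rewrite addn1.
Qed.

(* Six is the least level at which the marker is long enough for [marker_rigid]:
   3 (13 a + 8 b) <= 2 (20 a + 12 b). *)
Lemma tower_sizes B0 B1 :
  [/\ size (tower B0 B1 6 false) = 13 * size B0 + 8 * size B1,
      size (tower B0 B1 6 true) = 8 * size B0 + 5 * size B1 &
      size (marker B0 B1 6) = 20 * size B0 + 12 * size B1]%N.
Proof.
by split; rewrite /= !towerS !tower0 !size_cat /=; lia.
Qed.

Lemma tower_coprime B0 B1 k : coprime (size B0) (size B1) ->
  coprime (size (tower B0 B1 k false)) (size (tower B0 B1 k true)).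
Proof.
move=> co; elim: k => [|k IH]; first by rewrite !tower0.
by rewrite !towerS size_cat /coprime gcdnC gcdnDl.
Qed.

Definition unary B0 B1 : Prop := exists a, all (pred1 a) (B0 ++ B1).

(** Both blocks occur in the marker of level six. *)
Lemma marker_unary B0 B1 a : all (pred1 a) (marker B0 B1 6) -> unary B0 B1.
Proof.
rewrite /= !towerS !tower0 !all_cat /= => H; exists a.
by rewrite all_cat; move: H; rewrite /=; do ?case/andP=> ? //.
Qed.

(** All that recognizability needs of a pair of blocks. By [marked_le], |U| - |V| is at most |U|/2,
    so [marked_apart] also tells a block U from a block V by where it ends. *)
Record marked U V P : Prop := Marked {
  marked_gt0 : (0 < size V)%N;
  marked_lt : (size V < size U)%N;
  marked_le : (size U <= 2 * size V)%N;
  marked_prefix : forall a, prefix P (block U V a ++ P);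
  marked_apart : forall y d e,
    subword y d (size P) = P -> subword y e (size P) = P ->
    d <= e -> 2 * (e - d) <= (size U)%:Z -> d = e }.

Lemma tower_marked B0 B1 : (0 < size B0)%N -> (0 < size B1)%N ->
  coprime (size B0) (size B1) -> ~ unary B0 B1 ->
  marked (tower B0 B1 6 false) (tower B0 B1 6 true) (marker B0 B1 6).
Proof.
move=> B00 B10 co nun; have [sU sV sP] := tower_sizes B0 B1.
split; rewrite ?sU ?sV; try lia.
  by move=> a; have := marker_prefix B0 B1 6 a; case: a.
move=> y d e y_d y_e le_de le_U; apply: contrapT => neq_de; apply: nun.
have [q def_e] : exists q : nat, e = d + q%:Z by exists `|e - d|%N; lia.
rewrite def_e in y_e; have := tower_coprime 6 co => co6.
have [||||||a] := @marker_rigid _ _ _ y d q co6 _ _ _ _ y_d y_e;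
  rewrite ?sU ?sV ?sP //; try lia.
- exact: marker_prefix.
- exact: marker_prefix.
exact: marker_unary.
Qed.

End Words.

(** * Topology of the full shift *)

Definition agree (A : finType) (M : nat) (t : int) (x y : fullshift A) : Prop :=
  forall s, t - M%:Z <= s <= t + M%:Z -> x s = y s.

Lemma nbhs_fullshiftP (A : finType) (x : fullshift A) (U : set (fullshift A)) :
  nbhs x U <-> exists M, forall y, agree M 0 x y -> U y.
Proof.
pose W M : set (fullshift A) := [set y | agree M 0 x y].
split=> [nU|[M sub]].
  have FF : Filter (filter_from setT W).
    apply: filter_from_filter; first by exists 0%N.
    move=> M N _ _; exists (maxn M N) => // y ag; split=> s le_s; apply: ag; lia.
  (* The product topology is a supremum of coordinate topologies, so convergence of the filter of
     cylinders is checked one coordinate at a time. *)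
  suff FU : filter_from setT W --> x.
    by have [M _ sub] := FU _ nU; exists M.
  apply/cvg_sup => i V [_ [[O oO <-] Ox] sub].
  exists `|i|%N => // y ag; apply: sub; rewrite /= -ag //; lia.
apply: (@filterS _ _ _ (W M)) sub _.
have near1 i : nbhs x [set y | x i = y i].
  have nx : nbhs x ((fun y : fullshift A => y i) @^-1` [set x i]).
    apply: (@proj_continuous int (fun _ => discrete_topology A : topologicalType)).
    exact: (discrete_set1 (x i : discrete_topology A)).
  by apply: filterS nx => y /= ->.
elim: M => [|M IH].
  apply: filterS (near1 0) => y eq0 s le_s.
  by have -> : s = 0 by lia.
apply: filterS (filterI IH (filterI (near1 M.+1%:Z) (near1 (- M.+1%:Z)))).
move=> y [ag [eq1 eq2]] s le_s.
have [->|neq1] := eqVneq s (M.+1%:Z); first exact: eq1.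
have [->|neq2] := eqVneq s (- M.+1%:Z); first exact: eq2.
by apply: ag; lia.
Qed.

Lemma closed_agree (A : finType) (Y : set (fullshift A)) y : closed Y ->
  (forall M, exists2 y', Y y' & agree M 0 y y') -> Y y.
Proof.
move=> cY app; apply: cY => B /nbhs_fullshiftP [M sub].
by have [y' Yy' ag] := app M; exists y'; split=> //; apply: sub.
Qed.

Lemma local_continuous (A B : finType) (X : set (fullshift A))
    (f : fullshift A -> fullshift B) (N : nat) :
  (forall p p' t, X p -> X p' -> agree N t p p' -> f p t = f p' t) ->
  {within X, continuous f}.
Proof.
move=> loc; apply/subspace_continuousP => p Xp W /nbhs_fullshiftP [M sub].
apply/nbhs_fullshiftP; exists (M + N)%N => p' ag Xp'; apply: sub => s le_s.
by apply: loc => // s' le_s'; apply: ag; lia.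
Qed.

Lemma fullshift_compact (A : finType) : compact [set: fullshift A].
Proof.
have finA : compact [set: discrete_topology A].
  by apply: finite_compact; exact: finite_finset.
have := @tychonoff int (fun _ => discrete_topology A : topologicalType)
  _ (fun _ => finA).
by congr compact; apply/seteqP.
Qed.

(* Curtis-Hedlund-Lyndon *)
Lemma continuous_local (A B : finType) (X : set (fullshift A))
    (f : fullshift A -> fullshift B) :
  closed X -> {within X, continuous f} ->
  exists r, forall x x', X x -> X x' -> agree r 0 x x' -> f x 0 = f x' 0.
Proof.
move=> cX /subspace_continuousP ctsf.
have Xcompact : compact X.
  exact: subclosed_compact cX (@fullshift_compact A) _.
(* Compactness is used in its near-covering form: a radius valid near each point gives a common one.
   Near [x], two points that agree are both compared with [x]. *)
pose P (r : nat) (x : fullshift A) := X x ->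
  forall x', X x' -> agree r 0 x x' -> f x 0 = f x' 0.
have [x Xx|R _ sub] := (compact_near_coveringP X).1 Xcompact nat \oo P _.
  have nf : nbhs (f x) [set y | f x 0 = y 0].
    by apply/nbhs_fullshiftP; exists 0%N => y; apply; lia.
  have /nbhs_fullshiftP [M sub] := ctsf x Xx _ nf.
  exists ([set x' | agree M 0 x x'], [set r | (M <= r)%N]).
    by split; [apply/nbhs_fullshiftP; exists M | exists M].
  move=> [x1 r] [/= ag1 le_r] Xx1 x2 Xx2 ag2.
  have <- : f x 0 = f x1 0 by apply: sub.
  by apply: sub => // s le_s; rewrite ag1 // ag2 //; lia.
exists R => x x' Xx Xx' ag.
exact: (sub R (leqnn R) x Xx Xx x' Xx' ag).
Qed.

Section Conjugacy.
Variables (A B : finType) (X : set (fullshift A)) (Y : set (fullshift B)).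

(** Recoding is naturally a relation, since codings are only known to exist. Locality, applied to
    equal points, makes the relation single-valued both ways, and it also gives continuity of the
    two chosen maps. *)
Lemma local_relation_conjugate (R : fullshift A -> fullshift B -> Prop) (N : nat) :
  X !=set0 ->
  (forall p, X p -> exists2 y, Y y & R p y) ->
  (forall y, Y y -> exists2 p, X p & R p y) ->
  (forall p, X p -> X (shift p)) ->
  (forall p y, R p y -> R (shift p) (shift y)) ->
  (forall p p' y y' t, R p y -> R p' y' -> agree N t p p' -> y t = y' t) ->
  (forall p p' y y' t, R p y -> R p' y' -> agree N t y y' -> p t = p' t) ->
  conjugate X Y.
Proof.
move=> [p0 Xp0] totX totY shX shR locX locY.
have [y0 Yy0 _] := totX p0 Xp0.
pose f p := xget y0 [set y | Y y /\ R p y].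
pose g y := xget p0 [set p | X p /\ R p y].
have fP p : X p -> Y (f p) /\ R p (f p).
  move=> /totX [y Yy Rpy]; suff : [set y | Y y /\ R p y] (f p) by [].
  by apply: xgetPex; exists y.
have gP y : Y y -> X (g y) /\ R (g y) y.
  move=> /totY [p Xp Rpy]; suff : [set p | X p /\ R p y] (g y) by [].
  by apply: xgetPex; exists p.
have funR p y y' : R p y -> R p y' -> y = y'.
  by move=> Ry Ry'; apply/funext => t; apply: locX Ry Ry' _.
have funR' p p' y : R p y -> R p' y -> p = p'.
  by move=> Ry Ry'; apply/funext => t; apply: locY Ry Ry' _.
have fK : {in X, cancel f g}.
  move=> p /set_mem Xp; have [Yf Rf] := fP p Xp; have [_ Rg] := gP _ Yf.
  exact: funR' Rg Rf.
exists f => [|x Xx]; last first.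
  have [_ R1] := fP _ (shX _ Xx); have [_ /shR R2] := fP _ Xx.
  exact: funR R1 R2.
split; first split.
- by move=> p /fP [].
- exact: can_in_inj fK.
- move=> y Yy; have [Xg Rg] := gP y Yy; exists (g y) => //.
  by have [_ Rf] := fP _ Xg; apply: funR Rf Rg.
- apply: (@local_continuous _ _ _ _ N) => p p' t /fP [_ Rp] /fP [_ Rp'].
  exact: locX Rp Rp'.
exists g => //; apply: (@local_continuous _ _ _ _ N) => y y' t /gP [_ Ry] /gP [_ Ry'].
exact: locY Ry Ry'.
Qed.

End Conjugacy.

(** * Desubstitution and minimality of the Fibonacci shift *)

Lemma iter_fib_substS k :
  iter k.+1 fib_subst [:: false]
  = iter k fib_subst [:: false] ++ iter k fib_subst [:: true].
Proof. by rewrite iterSr -iter_fib_subst_cat. Qed.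

Lemma tower_letters k a :
  tower [:: false] [:: true] k a = iter k fib_subst [:: a].
Proof.
rewrite /tower; elim: (iter _ _ _) => //= b w IH.
by rewrite -[RHS]/([:: b] ++ w) -{2}IH /spell /=; case: b.
Qed.

Lemma fib_shift_local (x : fullshift bool) :
  (forall i m, exists j (x' : fullshift bool),
     fib_shift x' /\ subword x i m = subword x' j m) -> fib_shift x.
Proof. by move=> loc i m; have [j [x' [Xx' ->]]] := loc i m; apply: Xx'. Qed.

Lemma fib_shift_shift (x : fullshift bool) s :
  fib_shift x -> fib_shift (fun k => x (k + s)).
Proof.
move=> Xx; apply: fib_shift_local => i m; exists (i + s), x; split=> //.
by apply/eq_subwordP => k _; congr x; lia.
Qed.

Lemma fib_shift_closed : closed fib_shift.
Proof.
move=> x clx; apply: fib_shift_local => i m.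
have [|x' [Xx' ag]] := clx [set x' | agree (`|i| + m)%N 0 x x'].
  by apply/nbhs_fullshiftP; exists (`|i| + m)%N.
exists i, x'; split=> //; apply/eq_subwordP => k lt_k; apply: ag; lia.
Qed.

Lemma fib_subst_no11 w : sorted (fun a b => ~~ (a && b)) (fib_subst w).
Proof.
suff : forall b, path (fun a b => ~~ (a && b)) b (fib_subst w).
  by case: (fib_subst w) => //= a s /(_ false) /= .
rewrite /fib_subst; elim: w => //= -[] w IH b /=; rewrite andbF /=; exact: IH.
Qed.

Lemma fib_shift_no11 (x : fullshift bool) i : fib_shift x ->
  x i = true -> x (i + 1) = false.
Proof.
move=> Xx xi; have [[//|k] _] := Xx i 2%N; rewrite iterS.
move=> /infix_sorted /(_ (fib_subst_no11 _)).
by rewrite /subword /mkseq /= addr0 xi; case: (x _).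
Qed.

Lemma fib_subst_head w : exists s, fib_subst w ++ [:: false] = false :: s.
Proof. by case: w => [|[] w]; eexists. Qed.

(** The final 0 closes the last block: without it the image 0 of the letter 1 would be a prefix of
    the image 01 of the letter 0. *)
Lemma fib_subst_prefix w v :
  prefix (fib_subst w ++ [:: false]) (fib_subst v ++ [:: false]) -> prefix w v.
Proof.
elim: w v => [|a w IH] v; first by rewrite prefix0s.
have [s def_w] := fib_subst_head w.
case: v => [|b v].
  rewrite -[_ ++ _]/(fib_subst ([:: a] ++ w) ++ _) fib_subst_cat -catA def_w.
  by case: a.
have [s' def_v] := fib_subst_head v; move: (IH v).
rewrite -[a :: w]cat1s -[b :: v]cat1s !fib_subst_cat -!catA.
by rewrite {IH} def_w def_v; case: a; case: b.
Qed.

(** The occurrence starts with 0, and a 0 appears only at the start of a substituted block, so the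
    occurrence is aligned with the blocks of [v]. *)
Lemma fib_subst_infix w v :
  infix (fib_subst w ++ [:: false]) (fib_subst v) -> infix w v.
Proof.
case/infixP => s1 [s2]; elim: v s1 => [|b v IH] s1.
  by have [s ->] := fib_subst_head w; case: s1.
case: s1 => [|a s1] def_v.
  apply/prefixW/fib_subst_prefix; rewrite def_v.
  by rewrite cat0s -catA prefix_prefix.
apply: infix_trans (infix_cons v b).
have [s def_w] := fib_subst_head w; move: def_v; case: b.
  by case=> _; apply: IH.
case: s1 => [|a' s1]; first by rewrite def_w.
by case=> _ _; apply: IH.
Qed.

Lemma fib_shift_cuts (x : fullshift bool) : fib_shift x ->
  exists c : int -> int, forall k,
    x (c k) = false /\ c (k + 1) = c k + (if x (c k + 1) then 2 else 1).
Proof.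
move=> Xx; have no11 i := @fib_shift_no11 x i Xx.
have [z xz] : exists z, x z = false.
  by case x0 : (x 0); [exists (0 + 1); apply: no11 | exists 0].
pose nxt i := i + (if x (i + 1) then 2 else 1) : int.
pose prv i := i - (if x (i - 1) then 2 else 1) : int.
have x_nxt i : x i = false -> x (nxt i) = false.
  rewrite /nxt; case xi : (x (i + 1)) => // _.
  by have := no11 _ xi; congr (x _ = _); lia.
have x_prv i : x i = false -> x (prv i) = false.
  rewrite /prv; case xi : (x (i - 1)) => // _; case xi2 : (x (i - 2)) => //.
  have := no11 _ xi2; rewrite (_ : i - 2 + 1 = i - 1) ?xi //; lia.
have prvK i : x i = false -> nxt (prv i) = i.
  rewrite /nxt /prv => xi; case xi1 : (x (i - 1)).
    by rewrite (_ : i - 2 + 1 = i - 1) ?xi1; lia.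
  by rewrite (_ : i - 1 + 1 = i) ?xi; lia.
have xn n : x (iter n nxt z) = false by elim: n => //= n; apply: x_nxt.
have xp n : x (iter n prv z) = false by elim: n => //= n; apply: x_prv.
(* [Negz n] is -(n + 1), hence [n.+1] steps back from the zero at [z]. *)
exists (fun k => match k with
  | Posz n => iter n nxt z | Negz n => iter n.+1 prv z end).
case=> n; first by split; [exact: xn | rewrite -PoszD addn1].
split; first exact: xp.
have -> : Negz n + 1 = - n%:Z by lia.
have -> : match - n%:Z with Posz n => iter n nxt z | Negz n => iter n.+1 prv z end
    = iter n prv z by case: n.
by rewrite -[RHS]/(nxt (iter n.+1 prv z)) iterS prvK.
Qed.

(** Cut before every 0. For a factor w of [x'], the word phi(w)0 occurs in [x], hence in some
    phi^(k+1)(0), and then w occurs in phi^k(0). *)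
Lemma fib_shift_desubst (x : fullshift bool) : fib_shift x ->
  exists2 x', fib_shift x' &
    @concatenation_along _ [:: false; true] [:: false] x' x.
Proof.
move=> Xx; have [c cP] := fib_shift_cuts Xx.
pose x' : fullshift bool := fun k => ~~ x (c k + 1).
have cod : coding c [:: false; true] [:: false] x' x.
  move=> k; have [xk ->] := cP k; rewrite /block /x' /subword /mkseq.
  by case xk1: (x _); rewrite /= addr0 xk ?xk1.
exists x'; last by exists c.
move=> i m; have [codc cody] := coding_spell cod m i.
have sub : subword x (c i) (size (fib_subst (subword x' i m)) + 1)
    = fib_subst (subword x' i m) ++ [:: false].
  rewrite subwordD subword1 cody -codc.
  by have [-> _] := cP (i + m%:Z).
have [k k1 inf] := Xx (c i) (size (fib_subst (subword x' i m)) + 1)%N.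
exists k => //; apply: fib_subst_infix; rewrite -sub.
(* phi^k(0) is a prefix of phi^(k+1)(0); the extra level is the one that desubstitution removes. *)
by apply: infix_trans inf _; rewrite -[fib_subst _]iterS iter_fib_substS prefix_infix.
Qed.

Section Coded.
Variable A : finType.

Definition fib_coded (B0 B1 : seq A) (y : fullshift A) : Prop :=
  exists2 x, fib_shift x & concatenation_along B0 B1 x y.

Lemma fib_coded_tower B0 B1 y k : fib_coded B0 B1 y ->
  fib_coded (tower B0 B1 k false) (tower B0 B1 k true) y.
Proof.
move=> cod; elim: k => [|k [x Xx [c codx]]]; first by rewrite !tower0.
rewrite !towerS; have [x' Xx' conc] := fib_shift_desubst Xx.
by exists x' => //; apply: coding_lift codx _ conc.
Qed.

End Coded.

Lemma fib_coded_letters (x : fullshift bool) : fib_shift x ->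
  fib_coded [:: false] [:: true] x.
Proof.
move=> Xx; exists x => //; exists id => k; rewrite /block; case xk : (x k);
  by rewrite subword1 xk.
Qed.

(** Since 11 is forbidden, the desubstituted sequence of level [k] contains a 0, and its block is
    phi^k(0). *)
Lemma fib_shift_recurrent (x : fullshift bool) k : fib_shift x ->
  exists i, subword x i (size (iter k fib_subst [:: false]))
            = iter k fib_subst [:: false].
Proof.
move=> Xx.
have [x' Xx' [c cod]] := fib_coded_tower k (fib_coded_letters Xx).
have [j x'j] : exists j, x' j = false.
  case x0 : (x' 0); last by exists 0.
  by exists (0 + 1); apply: fib_shift_no11.
have [_] := cod j; rewrite x'j /block tower_letters => <-; exists (c j).
by rewrite size_subword.
Qed.

Lemma fib_shift_minimal (x x0 : fullshift bool) i m :
  fib_shift x -> fib_shift x0 -> exists i0, subword x0 i0 m = subword x i m.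
Proof.
move=> Xx Xx0; have [k _ /infixP [s1 [s2 def_k]]] := Xx i m.
have [j] := fib_shift_recurrent k Xx0; rewrite def_k !size_cat !subwordD => eq_sub.
exists (j + (size s1)%:Z).
have := congr1 (take m \o drop (size s1)) eq_sub.
by rewrite /= !drop_size_cat ?size_subword // !take_size_cat ?size_subword.
Qed.

Lemma fib_shift_01 (x : fullshift bool) : fib_shift x ->
  exists i, x i = false /\ x (i + 1) = true.
Proof.
move=> Xx; have [i] := fib_shift_recurrent 1 Xx.
by rewrite /subword /mkseq /= addr0 => -[xi xi1]; exists i.
Qed.

(** * Recognizability and recoding *)

Lemma cut_le (c : int -> int) : (forall k, c k < c (k + 1)) ->
  forall k (n : nat), c k + n%:Z <= c (k + n%:Z).
Proof.
move=> inc k; elim=> [|n IH]; first by rewrite !addr0.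
by have := inc (k + n%:Z); rewrite (_ : k + n%:Z + 1 = k + n.+1%:Z); lia.
Qed.

Lemma cut_cover (c : int -> int) : (forall k, c k < c (k + 1)) ->
  forall t : int, exists k : int, c k <= t < c (k + 1).
Proof.
move=> inc t.
have [k0 k0P] : exists k0, c k0 <= t.
  have [n nP] : exists n : nat, c 0 - t <= n%:Z by exists (absz (c 0 - t)%R); lia.
  exists (- n%:Z); have := cut_le inc (- n%:Z) n.
  by rewrite (_ : - n%:Z + n%:Z = (0 : int)); lia.
have : exists n : nat, t < c (k0 + n%:Z + 1).
  have [n nP] : exists n : nat, t - c k0 <= n%:Z by exists (absz (t - c k0)%R); lia.
  exists n; apply: le_lt_trans (inc _); have := cut_le inc k0 n; lia.
case/ex_minnP => -[|n] lt_t min_n.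
  by exists k0; rewrite k0P /=; rewrite addr0 in lt_t.
exists (k0 + n.+1%:Z); rewrite lt_t andbT leNgt; apply/negP => lt_t'.
suff /min_n : t < c (k0 + n%:Z + 1) by rewrite ltnn.
by rewrite (_ : k0 + n%:Z + 1 = k0 + n.+1%:Z) //; lia.
Qed.

Lemma cut_inj (c : int -> int) (t k l : int) : (forall k, c k < c (k + 1)) ->
  c k <= t < c (k + 1) -> c l <= t < c (l + 1) -> k = l.
Proof.
move=> inc; wlog le_kl : k l / k <= l => [wl|].
  by case: (leP k l) => [|/ltW] le ? ?; [|symmetry]; apply: wl.
move=> tk tl; apply/eqP; rewrite eq_le le_kl /= leNgt; apply/negP => lt_kl.
have := cut_le inc (k + 1) (absz (l - (k + 1))%R).
rewrite (_ : k + 1 + _ = l); lia.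
Qed.

Section Recoding.
Variable A : finType.
Implicit Types (U V P : seq A) (y : fullshift A).

Lemma coding_lt c U V (x : fullshift bool) y : (0 < size U)%N -> (0 < size V)%N ->
  coding c U V x y -> forall k, c k < c (k + 1).
Proof.
by move=> U0 V0 cod k; have [-> _] := cod k; rewrite /block; case: (x k); lia.
Qed.

Lemma coding_exists U V c (x : fullshift bool) : (0 < size U)%N -> (0 < size V)%N ->
  (forall k, c (k + 1) = c k + (size (block U V (x k)))%:Z) ->
  exists y, coding c U V x y.
Proof.
move=> U0 V0 cE.
have inc k : c k < c (k + 1) by rewrite cE /block; case: (x k); lia.
have [u _] : exists u : A, u \in U.
  by case: U U0 {cE} => // u U _; exists u; rewrite inE eqxx.
have [kk kkP] := choice (cut_cover inc).
exists (fun t => nth u (block U V (x (kk t))) (absz (t - c (kk t))%R)) => k; split=> //.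
apply: (@eq_from_nth _ u); rewrite size_subword // => i lti.
rewrite /subword nth_mkseq //.
have -> : kk (c k + i%:Z) = k.
  apply: cut_inj inc (kkP _) _; rewrite cE; lia.
by congr nth; lia.
Qed.

(** Recognizability. The markers after the cuts around [t] are visible in both sequences. If the
    last cuts up to [t] were more than |U|/2 apart, the later one would be within |U|/2 of the other
    coding's next cut, hence equal to it, although they lie on different sides of [t]. *)
Lemma coding_local U V P c (x : fullshift bool) y c' (x' : fullshift bool) y'
    (t k l : int) :
  marked U V P -> coding c U V x y -> coding c' U V x' y' ->
  agree (size U + size P) t y y' ->
  c k <= t < c (k + 1) -> c' l <= t < c' (l + 1) -> c k = c' l /\ x k = x' l.
Proof.
move=> mUV cod cod' ag tk tl.
have [V0 lt_VU le_UV pr apart] := mUV; have U0 : (0 < size U)%N by lia.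
have site := coding_marker U0 V0 pr cod; have site' := coding_marker U0 V0 pr cod'.
have [ck _] := cod k; have [cl _] := cod' l.
have le_k : c (k + 1) <= c k + (size U)%:Z.
  by rewrite ck /block; case: (x k); lia.
have le_l : c' (l + 1) <= c' l + (size U)%:Z.
  by rewrite cl /block; case: (x' l); lia.
have yk : subword y' (c k) (size P) = P.
  by rewrite -[RHS](site k); apply/eq_subwordP => i lti; rewrite ag //; lia.
have yk1 : subword y' (c (k + 1)) (size P) = P.
  by rewrite -[RHS](site (k + 1)); apply/eq_subwordP => i lti; rewrite ag //; lia.
have near d e : subword y' d (size P) = P -> subword y' e (size P) = P ->
    2 * `|e - d| <= (size U)%:Z -> d = e.
  move=> yd ye le_de; case: (leP d e) => le; first by apply: (apart y') => //; lia.
  by symmetry; apply: (apart y') => //; lia.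
have eq_c : c k = c' l.
  case: (leP (c k) (c' l)) => le.
    case: (leP (2 * (c' l - c k)) (size U)%:Z) => le2; first by apply: near => //; lia.
    have := near (c' l) (c (k + 1)) (site' l) yk1; lia.
  case: (leP (2 * (c k - c' l)) (size U)%:Z) => le2; first by apply: near => //; lia.
  have := near (c k) (c' (l + 1)) yk (site' _); lia.
(* The next cuts differ by at most |U| - |V| <= |U|/2, so they coincide, and |V| < |U| makes the
   letters equal. *)
have := near (c (k + 1)) (c' (l + 1)) yk1 (site' _).
rewrite ck cl eq_c /block; case: (x k); case: (x' l) => // H; split=> //; exfalso; lia.
Qed.

Lemma subshift_shift (Y : set (fullshift A)) y (s : int) : subshift Y -> Y y ->
  Y (fun k => y (k + s)).
Proof.
case=> _ _ invY; case: s => n; elim: n y => [|n IH] y Yy.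
- by rewrite (_ : (fun _ => _) = y) //; apply/funext => k; rewrite addr0.
- have : Y (shift y) by rewrite -invY; exists y.
  by move=> /IH; congr Y; apply/funext => k; rewrite /shift; congr y; lia.
- move: Yy; rewrite -{1}invY => -[z Yz <-].
  by move: Yz; congr Y; apply/funext => k; rewrite /shift; congr z; lia.
move: Yy; rewrite -{1}invY => -[z Yz <-]; move: (IH z Yz).
by congr Y; apply/funext => k; rewrite /shift; congr z; lia.
Qed.

(** By minimality every factor of [x] occurs in the code of one point of [Y], so translates of that
    point approximate [y], and [Y] is closed. *)
Lemma coded_subshift_full (Y : set (fullshift A)) U V c (x : fullshift bool) y :
  subshift Y -> (0 < size U)%N -> (0 < size V)%N ->
  (forall y, Y y -> fib_coded U V y) ->
  fib_shift x -> coding c U V x y -> Y y.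
Proof.
move=> sY U0 V0 codY Xx cod; have [[y0 Yy0] cY _] := sY.
have [x0 Xx0 [c0 cod0]] := codY y0 Yy0.
apply: closed_agree cY _ => M.
have inc := coding_lt U0 V0 cod.
have [i i_le] := cut_cover inc (- M%:Z).
have [m m_ge] : exists m : nat, M%:Z < c (i + m%:Z).
  exists (`|c i| + M).+1; have := cut_le inc i (`|c i| + M).+1; lia.
have [i0 eq_x] := fib_shift_minimal i m Xx Xx0.
have [ci yi] := coding_spell cod m i; have [_] := coding_spell cod0 m i0.
rewrite eq_x -yi size_subword => /eq_subwordP eq_y.
exists (fun k => y0 (k + (c0 i0 - c i))); first exact: subshift_shift _ sY Yy0.
move=> s le_s; have [j def_s] : exists j : nat, s = c i + j%:Z.
  by exists (absz (s - c i)%R); lia.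
rewrite def_s -eq_y; last by move: m_ge; rewrite ci; lia.
by congr y0; lia.
Qed.

End Recoding.

Lemma coding_recode (A B : finType) (C0 C1 P : seq A) (B0 B1 : seq B)
    c (x : fullshift bool) p y c' (x' : fullshift bool) p' y' (t : int) :
  marked C0 C1 P -> size C0 = size B0 -> size C1 = size B1 ->
  coding c C0 C1 x p -> coding c' C0 C1 x' p' ->
  coding c B0 B1 x y -> coding c' B0 B1 x' y' ->
  agree (size C0 + size P) t p p' -> y t = y' t.
Proof.
move=> mC s0 s1 codp codp' cody cody' ag.
have V0 := marked_gt0 mC; have U0 : (0 < size C0)%N by have := marked_lt mC; lia.
have [k tk] := cut_cover (coding_lt U0 V0 codp) t.
have [l tl] := cut_cover (coding_lt U0 V0 codp') t.
have [eq_c eq_x] := coding_local mC codp codp' ag tk tl.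
have [ck yk] := cody k; have [_ yl] := cody' l.
have /eq_subwordP eq_y : subword y (c k) (size (block B0 B1 (x k)))
    = subword y' (c' l) (size (block B0 B1 (x k))) by rewrite yk {2}eq_x yl eq_x.
have := eq_y (absz (t - c k)%R); rewrite -eq_c (_ : c k + _ = t); last by lia.
by apply; move: tk; rewrite ck; lia.
Qed.

Lemma coded_conjugate (A B : finType) (X : set (fullshift A)) (Y : set (fullshift B))
    (C0 C1 P : seq A) (B0 B1 Q : seq B) :
  subshift X -> subshift Y -> marked C0 C1 P -> marked B0 B1 Q ->
  size C0 = size B0 -> size C1 = size B1 ->
  (forall p, X p -> fib_coded C0 C1 p) -> (forall y, Y y -> fib_coded B0 B1 y) ->
  conjugate X Y.
Proof.
move=> sX sY mC mB s0 s1 codX codY.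
have V0 := marked_gt0 mC; have U0 : (0 < size C0)%N by have := marked_lt mC; lia.
have V0' := V0; have U0' := U0; rewrite s0 in U0'; rewrite s1 in V0'.
(* Same code and same cuts, different blocks. *)
pose R p y := exists x c, [/\ fib_shift x, coding c C0 C1 x p & coding c B0 B1 x y].
have sz a : size (block C0 C1 a) = size (block B0 B1 a) by case: a.
(* One radius that serves both directions of the recoding. *)
pose N := (size C0 + size P + (size B0 + size Q))%N.
apply: (@local_relation_conjugate _ _ _ _ R N).
- by case: sX.
- move=> p /codX [x Xx [c cod]]; have [|y cody] := @coding_exists _ B0 B1 c x U0' V0'.
    by move=> k; have [-> _] := cod k; rewrite sz.
  exists y; last by exists x, c.
  exact: coded_subshift_full sY U0' V0' codY Xx cody.
- move=> y /codY [x Xx [c cod]]; have [|p codp] := @coding_exists _ C0 C1 c x U0 V0.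
    by move=> k; have [-> _] := cod k; rewrite sz.
  exists p; last by exists x, c.
  exact: coded_subshift_full sX U0 V0 codX Xx codp.
- move=> p Xp; exact: (subshift_shift 1 sX Xp).
- have shift_coding (D : finType) (D0 D1 : seq D) c x z :
      coding c D0 D1 x z -> coding (fun k => c k - 1) D0 D1 x (shift z).
    move=> cod k; have [ck zk] := cod k; split; first by rewrite ck; lia.
    rewrite -[RHS]zk; apply/eq_subwordP => i _; rewrite /shift; congr z; lia.
  move=> p y [x [c [Xx codp cody]]]; exists x, (fun k => c k - 1).
  by split=> //; apply: shift_coding.
- move=> p p' y y' t [x [c [_ codp cody]]] [x' [c' [_ codp' cody']]] ag.
  apply: coding_recode mC s0 s1 codp codp' cody cody' _ => s le_s; apply: ag; lia.
- move=> p p' y y' t [x [c [_ codp cody]]] [x' [c' [_ codp' cody']]] ag.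
  apply: coding_recode mB (esym s0) (esym s1) cody cody' codp codp' _ => s le_s.
  by apply: ag; lia.
Qed.

(** * Fibonacci block lengths, and conjugacy from a coding *)

Lemma fib_subshift : fib_shift !=set0 -> subshift fib_shift.
Proof.
move=> ne; split=> //; first exact: fib_shift_closed.
apply/seteqP; split=> [_ [x Xx <-]|x Xx]; first exact: fib_shift_shift Xx.
exists (fun k => x (k - 1)); first exact: fib_shift_shift Xx.
by apply/funext => k; rewrite /shift addrK.
Qed.

Lemma fibSS n : fib n.+2 = (fib n.+1 + fib n)%N.
Proof. by []. Qed.

Lemma fib_gt0 n : (0 < fib n.+1)%N.
Proof. by elim: n => // n; rewrite fibSS; lia. Qed.

Section Towers.
Variable A : finType.
Implicit Types (B U V P : seq A) (y : fullshift A).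

Lemma size_tower_fib B0 B1 n : size B0 = fib n.+1 -> size B1 = fib n -> forall k,
  size (tower B0 B1 k false) = fib (k + n).+1 /\
  size (tower B0 B1 k true) = fib (k + n).
Proof.
move=> s0 s1; elim=> [|k [IH0 IH1]]; first by rewrite !tower0.
by rewrite !towerS size_cat IH0 IH1 addSn fibSS.
Qed.

Lemma coding_unary c B0 B1 (x : fullshift bool) y a :
  (0 < size B0)%N -> (0 < size B1)%N -> coding c B0 B1 x y ->
  all (pred1 a) (B0 ++ B1) -> forall t, y t = a.
Proof.
move=> B00 B10 cod; rewrite all_cat => /andP [all0 all1] t.
have [k] := cut_cover (coding_lt B00 B10 cod) t.
have [-> yk] := cod k => tk.
have alla : all (pred1 a) (block B0 B1 (x k)) by rewrite /block; case: (x k).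
have [i [lt_i ->]] : exists i : nat,
    (i < size (block B0 B1 (x k)))%N /\ t = c k + i%:Z.
  by exists (absz (t - c k)%R); lia.
rewrite -(nth_subword a y (c k) lt_i) yk.
by apply/eqP; move/all_nthP: alla => /(_ a i lt_i).
Qed.

(** Recognizability applied to [y] and itself: the two codings have the same cuts and letters up to
    a shift of the index, so [x] and [x'] have the same factors. *)
Lemma coding_unique_fib c c' U V P (x x' : fullshift bool) y :
  marked U V P -> coding c U V x y -> coding c' U V x' y ->
  fib_shift x' -> fib_shift x.
Proof.
move=> mUV cod cod' Xx'; apply: fib_shift_local => i m.
have V0 := marked_gt0 mUV; have U0 : (0 < size U)%N by have := marked_lt mUV; lia.
have inc := coding_lt U0 V0 cod; have inc' := coding_lt U0 V0 cod'.
have ag t : agree (size U + size P) t y y by [].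
have same k l : c k = c' l -> x k = x' l.
  move=> eq_c.
  have [||//] := @coding_local _ U V P c x y c' x' y (c k) k l mUV cod cod' (ag _).
    by rewrite lexx inc.
  by rewrite eq_c lexx inc'.
have [j tj] := cut_cover inc' (c i).
have ti : c i <= c i < c (i + 1) by rewrite lexx inc.
have [eq_c _] := coding_local mUV cod cod' (ag _) ti tj.
have eq_cn n : c (i + n%:Z) = c' (j + n%:Z).
  elim: n => [|n IH]; first by rewrite !addr0.
  have succ (k : int) : k + n.+1%:Z = k + n%:Z + 1 by lia.
  have [ck _] := cod (i + n%:Z); have [cl _] := cod' (j + n%:Z).
  by rewrite !succ ck cl (same _ _ IH) IH.
by exists j, x'; split=> //; apply/eq_subwordP => n _; apply: same.
Qed.

Lemma coding_after c U V P (x : fullshift bool) y k r :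
  (0 < size U)%N -> (0 < size V)%N -> (forall a, prefix P (block U V a ++ P)) ->
  coding c U V x y -> (r <= size P)%N ->
  subword y (c k) (size (block U V (x k)) + r) = block U V (x k) ++ take r P.
Proof.
move=> U0 V0 prP cod le_r; have [ck yk] := cod k.
rewrite subwordD yk -ck -(take_subword _ _ le_r).
by rewrite (coding_marker U0 V0 prP cod).
Qed.

(* A unary pair of blocks would make the constant sequence [0] a coding. *)
Lemma coded_nonunary (Y : set (fullshift A)) B0 B1 :
  Y !=set0 -> (0 < size B0)%N -> (0 < size B1)%N ->
  (forall y, Y y -> exists x, concatenation_along B0 B1 x y) ->
  (forall y x, Y y -> concatenation_along B0 B1 x y -> fib_shift x) ->
  ~ unary B0 B1.
Proof.
move=> [y Yy] B00 B10 codY onlyX [a alla].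
have [x [c cod]] := codY y Yy; have ya := coding_unary B00 B10 cod alla.
pose x0 : fullshift bool := fun _ => false.
suff /fib_shift_01 [i []] : fib_shift x0 by [].
apply: (onlyX y) => //; exists (fun k => k * (size B0)%:Z) => k; split.
  by rewrite mulrDl mul1r.
apply: (@eq_from_nth _ a); rewrite size_subword // => i lti.
rewrite nth_subword // ya; apply/esym/eqP.
by move: alla; rewrite all_cat => /andP [/(all_nthP a) /(_ i lti)].
Qed.

End Towers.

Lemma conjugate_of_coded (A : finType) (Y : set (fullshift A)) n (B0 B1 : seq A) :
  subshift Y -> (3 <= n)%N -> size B0 = fib n -> size B1 = fib n.-1 ->
  (forall y, Y y -> exists x, concatenation_along B0 B1 x y) ->
  (forall y x, Y y -> concatenation_along B0 B1 x y -> fib_shift x) ->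
  conjugate fib_shift Y.
Proof.
case: n => [|[|[|n]]] // sY _ s0 s1 codY onlyX; have [neY _ _] := sY.
have [y0 Yy0] := neY.
(* The code of a point of [Y] witnesses that the Fibonacci shift is nonempty. *)
have [x0 conc0] := codY y0 Yy0; have Xx0 := onlyX y0 x0 Yy0 conc0.
(* Single letters have lengths F_2 = F_1 = 1, so level [n.+1] has exactly the lengths of [B0] and
   [B1]. *)
pose G a := tower [:: false] [:: true] n.+1 a.
have [sG0 sG1] : size (G false) = fib n.+3 /\ size (G true) = fib n.+2.
  have [] := @size_tower_fib _ [:: false] [:: true] 1 erefl erefl n.+1.
  by rewrite addn1.
have coG : coprime (size (G false)) (size (G true)) by apply: tower_coprime.
have G0 : (0 < size (G false))%N by rewrite sG0 fib_gt0.
have G1 : (0 < size (G true))%N by rewrite sG1 fib_gt0.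
have B00 : (0 < size B0)%N by rewrite s0 -sG0.
have B10 : (0 < size B1)%N by rewrite s1 -sG1.
have codG x : fib_shift x -> fib_coded (G false) (G true) x.
  by move=> /fib_coded_letters; apply: fib_coded_tower.
have nuG : ~ unary (G false) (G true).
  move=> [a alla]; have [i [xi xi1]] := fib_shift_01 Xx0.
  have [x' _ [c cod]] := codG x0 Xx0; have x0a := coding_unary G0 G1 cod alla.
  by move: xi xi1; rewrite !x0a => ->.
have nuB : ~ unary B0 B1 by apply: coded_nonunary codY onlyX.
have mG := tower_marked G0 G1 coG nuG.
have mB : marked (tower B0 B1 6 false) (tower B0 B1 6 true) (marker B0 B1 6).
  (* Coprimality is inherited from the blocks [G], which have the same lengths. *)
  by apply: tower_marked => //; rewrite s0 s1 -sG0 -sG1.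
have [sG60 sG61 _] := tower_sizes (G false) (G true).
have [sB60 sB61 _] := tower_sizes B0 B1.
apply: coded_conjugate mG mB _ _ _ _ => //.
- by apply: fib_subshift; exists x0.
- by rewrite sG60 sB60 sG0 sG1 s0 s1.
- by rewrite sG61 sB61 sG0 sG1 s0 s1.
- by move=> x /codG; apply: fib_coded_tower.
move=> y Yy; apply: fib_coded_tower; have [x conc] := codY y Yy.
by exists x => //; apply: onlyX conc.
Qed.

(** * Block structure of the images of sliding block codes *)

Section Factor.
Variables (A : finType) (psi : fullshift bool -> fullshift A).
Hypothesis psi_shift : forall x, fib_shift x -> psi (shift x) = shift (psi x).

Lemma equivariant_int (x : fullshift bool) (s t : int) :
  fib_shift x -> psi (fun k => x (k + s)) t = psi x (t + s).
Proof.
have pos (z : fullshift bool) (n : nat) u : fib_shift z ->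
    psi (fun k => z (k + n%:Z)) u = psi z (u + n%:Z).
  elim: n z u => [|n IH] z u Xz.
    by congr (psi _ _); [apply/funext => k|]; rewrite addr0.
  rewrite (_ : (fun _ => _) = (fun k => shift z (k + n%:Z))); last first.
    by apply/funext => k; rewrite /shift; congr z; lia.
  rewrite IH; last exact: fib_shift_shift.
  by rewrite psi_shift // /shift; congr (psi z _); lia.
move=> Xx; case: s => n; first exact: pos.
have Xz := fib_shift_shift (Negz n) Xx.
rewrite -[t in LHS](_ : (t + Negz n) + n.+1%:Z = t); last by lia.
rewrite -pos //; congr (psi _ _); apply/funext => k; congr x; lia.
Qed.

Variable r : nat.
Hypothesis psi_local0 : forall x x',
  fib_shift x -> fib_shift x' -> agree r 0 x x' -> psi x 0 = psi x' 0.

Lemma equivariant_local (x x' : fullshift bool) (t t' : int) :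
  fib_shift x -> fib_shift x' ->
  (forall s, - r%:Z <= s <= r%:Z -> x (t + s) = x' (t' + s)) -> psi x t = psi x' t'.
Proof.
move=> Xx Xx' ag; rewrite -[t]add0r -[t']add0r -!equivariant_int //.
apply: psi_local0; [exact: fib_shift_shift | exact: fib_shift_shift |].
by move=> s le_s; rewrite ![s + _]addrC; apply: ag; lia.
Qed.

(* After a cut, the words [phi^k(0)] and [phi^k(1)] are both followed by the
   marker; once it has length at least [2r], the image of such a word, shifted
   right by [r], depends only on the word. *)
Lemma factor_blocks (k : nat) : (2 * r <= k)%N -> fib_shift !=set0 ->
  exists b : bool -> seq A,
    (forall a, size (b a) = size (tower [:: false] [:: true] k a)) /\
    (forall x c x', fib_shift x ->
       coding c (tower [:: false] [:: true] k false)
                (tower [:: false] [:: true] k true) x' x ->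
       coding (fun j => c j + r%:Z) (b false) (b true) x' (psi x)).
Proof.
move=> le_rk [xs Xxs].
pose G a := tower [:: false] [:: true] k a; pose M := marker [:: false] [:: true] k.
have G0 a : (0 < size (G a))%N.
  suff : (0 < size (G false) /\ 0 < size (G true))%N by case; case: a.
  rewrite /G; elim: k {le_rk G M} => [|k [IH0 IH1]]; first by rewrite !tower0.
  by rewrite !towerS size_cat; lia.
have prM a : prefix M (block (G false) (G true) a ++ M).
  by have := marker_prefix [:: false] [:: true] k a; case: a.
have le_M : (2 * r <= size M)%N by apply: leq_trans le_rk _; apply: marker_size.
have [xs' Xxs' [cs cods]] := fib_coded_tower k (fib_coded_letters Xxs).
have [j0 [xj0 xj1]] := fib_shift_01 Xxs'.
(* An occurrence of 01 in the reference code provides one place for each letter, where the block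
   [b a] is read off. *)
pose js (a : bool) : int := if a then j0 + 1 else j0.
have xjs a : xs' (js a) = a by case: a.
pose b a := subword (psi xs) (cs (js a) + r%:Z) (size (G a)).
have sz_b a : size (b a) = size (G a) by rewrite size_subword.
exists b; split=> // x c x' Xx cod j; have [cj _] := cod j.
have blk a : block (b false) (b true) a = b a by case: a.
have blkG a : block (G false) (G true) a = G a by case: a.
rewrite blk sz_b; split; first by rewrite cj blkG; lia.
apply/eq_subwordP => i lti; apply: equivariant_local => // s le_s.
have eq1 := coding_after j (G0 _) (G0 _) prM cod le_M.
have := coding_after (js (x' j)) (G0 _) (G0 _) prM cods le_M.
(* The offset [r + i + s] runs from 0 to below the block length plus [2r], so it stays within the
   block and the marker letters after it. *)
rewrite xjs -eq1 => /esym/eq_subwordP /(_ (absz (r%:Z + i%:Z + s)%R)) eq2.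
have : (absz (r%:Z + i%:Z + s)%R < size (block (G false) (G true) (x' j)) + 2 * r)%N.
  by rewrite blkG; lia.
move/eq2; rewrite (_ : c j + _ = c j + r%:Z + i%:Z + s); last by lia.
by rewrite (_ : cs _ + _ = cs (js (x' j)) + r%:Z + i%:Z + s); last by lia.
Qed.

End Factor.

(** The blocks given by [factor_blocks] code every point of [Y], but another coding by them might
    not come from the Fibonacci shift; six levels higher the coding is unique. *)
Lemma coded_of_conjugate (A : finType) (Y : set (fullshift A)) :
  subshift Y -> conjugate fib_shift Y ->
  exists (n : nat) (B0 B1 : seq A),
    [/\ (3 <= n)%N, size B0 = fib n, size B1 = fib n.-1,
        forall y, Y y -> exists x, concatenation_along B0 B1 x y &
        forall y x, Y y -> concatenation_along B0 B1 x y -> fib_shift x].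
Proof.
move=> [[y0 Yy0] _ _] [psi [[psiY psi_inj psi_surj] psi_cts _] psi_shift].
have [r loc] := continuous_local fib_shift_closed psi_cts.
have [x0 Xx0 _] := psi_surj y0 Yy0; have ne : fib_shift !=set0 by exists x0.
have [b [sz_b codb]] := factor_blocks psi_shift loc (leqnn _) ne.
set k := (2 * r)%N in sz_b codb.
have [sG0 sG1] := @size_tower_fib _ [:: false] [:: true] 1 erefl erefl k.
have sb0 := sz_b false; have sb1 := sz_b true; rewrite sG0 in sb0; rewrite sG1 in sb1.
have b0 : (0 < size (b false))%N by rewrite sb0 fib_gt0.
have b1 : (0 < size (b true))%N by rewrite sb1 addn1 fib_gt0.
have codY y : Y y -> fib_coded (b false) (b true) y.
  case/psi_surj => x Xx <-.
  have [x' Xx' [c cod]] := fib_coded_tower k (fib_coded_letters Xx).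
  by exists x' => //; exists (fun j => c j + r%:Z); apply: codb cod.
have nub : ~ unary (b false) (b true).
  (* Unary blocks would give [x0] and its shift the same constant image, against injectivity, as
     [x0] contains 01. *)
  move=> [a alla]; have psia x : fib_shift x -> forall t, psi x t = a.
    move=> Xx; have [x' _ [c cod]] := codY _ (psiY _ Xx).
    exact: coding_unary b0 b1 cod alla.
  have [i [xi xi1]] := fib_shift_01 Xx0.
  have Xs : fib_shift (shift x0) by apply: fib_shift_shift.
  have : shift x0 = x0.
    apply: psi_inj; rewrite ?inE //; apply/funext => t.
    by rewrite !psia.
  by move/(congr1 (fun x : fullshift bool => x i)); rewrite /shift xi1 xi.
have cob : coprime (size (b false)) (size (b true)).
  by rewrite !sz_b; apply: tower_coprime.
have mb := tower_marked b0 b1 cob nub.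
have [s0 s1] := size_tower_fib sb0 sb1 6.
(* [b] has lengths F_(k+2) and F_(k+1); six levels raise both indices by 6. *)
exists (6 + (k + 1)).+1, (tower (b false) (b true) 6 false),
  (tower (b false) (b true) 6 true).
split=> // [y Yy|y x Yy [c cod]]; have [x' Xx' conc] := fib_coded_tower 6 (codY y Yy).
  by exists x'.
by have [c' cod'] := conc; apply: coding_unique_fib mb cod cod' Xx'.
Qed.

Theorem theorem3p1 (A : finType) (Y : set (fullshift A)) (hY : subshift Y) :
  conjugate fib_shift Y <->
  exists (n : nat) (B0 B1 : seq A),
    [/\ (3 <= n)%N,
        size B0 = fib n,
        size B1 = fib n.-1,
        forall y, Y y -> exists x, concatenation_along B0 B1 x y &
        forall y x, Y y -> concatenation_along B0 B1 x y -> fib_shift x].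
Proof.
split; first exact: coded_of_conjugate.
case=> n [B0 [B1 [n3 s0 s1 codY onlyX]]].
exact: conjugate_of_coded hY n3 s0 s1 codY onlyX.
Qed.
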